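(* Let $\widetilde{M}$ be a catenary, cycle, or mammillary model that has exactly one input and exactly one output, both in the first compartment (so $In=Out=\{1\}$), and exactly one leak (in an arbitrary compartment). Then $\widetilde{M}$ is generically locally identifiable, and so is the model $M$ obtained from $\widetilde M$ by removing the leak (i.e., replacing $Leak$ by $\emptyset$).
   Context: A linear compartmental model $(G,In,Out,Leak)$ consists of a directed graph $G=(V,E)$ with $V=\{1,\dots,n\}$ (vertices are called compartments) and subsets $In,Out,Leak\subseteq V$, with $Out\neq\emptyset$. Each edge $j\to i$ has a parameter $k_{ij}$, and each $j\in Leak$ has a parameter $k_{0j}$. The compartmental matrix $A$ is the $n\times n$ matrix with off-diagonal entries $A_{ij}=k_{ij}$ if $j\to i\in E$ and $0$ otherwise, and diagonal entries $A_{ii}=-\sum_{p:\,i\to p\in E}k_{pi}$ if $i\notin Leak$, $A_{ii}=-k_{0i}-\sum_{p:\,i\to p\in E}k_{pi}$ if $i\in Leak$. Let $\partial I$ be the $n\times n$ diagonal matrix with all diagonal entries the differential operator $d/dt$, and let $(B)_{ji}$ denote $B$ with row $j$ and column $i$ removed. The input-output equations are, for $i\in Out$, $$\det(\partial I-A)\,y_i=\sum_{j\in In}(-1)^{i+j}\det\big((\partial I-A)_{ji}\big)\,u_j ,$$ with both sides expanded in powers of $d/dt$ (i.e., in derivatives of the $y_i$ and $u_j$). The coefficient map $c:\mathbb{R}^{|E|+|Leak|}\to\mathbb{R}^m$ sends the vector of parameters to the vector of all non-monic coefficients of these equations (coefficients identically equal to $1$ are omitted, as are coefficients identically $0$). A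 model that is strongly connected (i.e. $G$ is strongly connected) with at least one input is generically locally identifiable if, outside a set of measure zero, every point of $\mathbb{R}^{|E|+|Leak|}$ has an open neighborhood $U$ such that $c|_U$ is one-to-one. Families of graphs on $\{1,\dots,n\}$: the catenary graph has edges $i\to i+1$ and $i+1\to i$ for $1\le i\le n-1$; the cycle graph has edges $1\to2\to3\to\cdots\to n\to1$ ($n\ge3$; smaller cases reduce to catenary graphs); the mammillary graph has edges $1\to i$ and $i\to 1$ for $2\le i\le n$. A catenary (respectively cycle, mammillary) model is a linear compartmental model whose graph $G$ is a catenary (respectively cycle, mammillary) graph for some $n$. *)

(* Defs.v *)
From HB Require Import structures.
From mathcomp Require Import all_boot all_order all_algebra.
From mathcomp Require Import all_classical all_reals all_analysis.

Set Implicit Arguments.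
Unset Strict Implicit.
Unset Printing Implicit Defensive.

Import Order.TTheory GRing.Theory Num.Theory.
Import numFieldNormedType.Exports.

Local Open Scope classical_set_scope.
Local Open Scope ring_scope.

(* Compartments 1, ..., n are represented by the ordinals 0, ..., n - 1.      *)
Record model (n : nat) : Type := Model {
  edge : rel 'I_n;
  edge_irr : irreflexive edge;
  inputs : {set 'I_n};
  outputs : {set 'I_n};
  leaks : {set 'I_n};
  outputs_neq0 : outputs != finset.set0
}.

Definition remove_leaks n (M : model n) : model n :=
  Model (edge_irr M) (inputs M) finset.set0 (outputs_neq0 M).

Definition strongly_connected n (M : model n) : Prop :=
  forall i j : 'I_n, connect (edge M) i j.

Definition catenary n (M : model n) : Prop :=
  forall i j : 'I_n,
    edge M i j = ((j == i.+1 :> nat) || (i == j.+1 :> nat))%N.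

Definition cycle_model n (M : model n) : Prop :=
  (3 <= n)%N /\ forall i j : 'I_n, edge M i j = (j == i.+1 %% n :> nat)%N.

Definition mammillary n (M : model n) : Prop :=
  forall i j : 'I_n,
    edge M i j = ((i == 0%N :> nat) && (j != 0%N :> nat))
              || ((j == 0%N :> nat) && (i != 0%N :> nat)).

(* An edge i -> j is the pair (i, j); its parameter is k_{ji}.                *)
Definition param n (M : model n) : finType :=
  ({e : 'I_n * 'I_n | edge M e.1 e.2} + {j : 'I_n | j \in leaks M})%type.

Definition pspace (R : realType) n (M : model n) := 'rV[R]_#|param M|.

Section Coefficients.
Variables (R : realType) (n : nat) (M : model n).
Implicit Types (k : pspace R M) (i j : 'I_n).

(* k_{ij}, or 0 when j -> i is not an edge *)
Definition rate k i j : R :=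
  if insub (j, i) : option {e : 'I_n * 'I_n | edge M e.1 e.2} is Some e
  then k 0 (enum_rank (inl e : param M)) else 0.

(* k_{0j}, or 0 when j is not a leak *)
Definition leak_rate k j : R :=
  if insub j : option {j : 'I_n | j \in leaks M} is Some l
  then k 0 (enum_rank (inr l : param M)) else 0.

Definition comp_mx k : 'M[R]_n :=
  \matrix_(i, j) if i == j then - leak_rate k i - \sum_(p | edge M i p) rate k p i
                 else rate k i j.

(* Constant-coefficient differential operators are polynomials in 'X = d/dt,  *)
(* and char_poly_mx A is 'X I - A.                                            *)
Definition lhs_op k : {poly R} := \det (char_poly_mx (comp_mx k)).

Definition rhs_op k i j : {poly R} :=
  (-1) ^+ (i + j) * \det (row' j (col' i (char_poly_mx (comp_mx k)))).

(* (i, None, d) stands for the term y_i^(d), and (i, Some j, d) for the term  *)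
(* u_j^(d), of the equation of the output i.                                  *)
Definition term : finType := ('I_n * option 'I_n * 'I_n.+1)%type.

Definition in_equations (t : term) : bool :=
  let: (i, v, _) := t in
  (i \in outputs M) && (if v is Some j then j \in inputs M else true).

Definition coeff k (t : term) : R :=
  let: (i, v, d) := t in
  (if v is Some j then rhs_op k i j else lhs_op k)`_d.

Definition coeff_terms : {set term} :=
  finset (fun t : term => in_equations t &&
    `[< ~ (forall k, coeff k t = 0) /\ ~ (forall k, coeff k t = 1) >]).

Definition coeff_map k : 'rV[R]_#|coeff_terms| :=
  \row_r coeff k (enum_val r).

End Coefficients.

(* Lebesgue-null sets of R^N. The boxes are indexed by a subset of nat, so    *)
(* that the cover may be empty: in R^0 every box has volume 1.                *)
Definition measure_zero (R : realType) (N : nat) (Z : set 'rV[R]_N) : Prop :=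
  forall eps : R, 0 < eps ->
  exists (D : set nat) (a b : nat -> 'rV[R]_N),
    [/\ forall m i, a m 0 i <= b m 0 i,
        Z `<=` \bigcup_(m in D)
          [set x : 'rV[R]_N | forall i, a m 0 i <= x 0 i <= b m 0 i]
      & (\esum_(m in D) (\prod_i (b m 0 i - a m 0 i))%:E <= eps%:E)%E].

Definition gen_loc_identifiable (R : realType) n (M : model n) : Prop :=
  [/\ strongly_connected M,
      inputs M != finset.set0
    & exists Z : set (pspace R M), measure_zero Z /\
        forall k, ~ Z k ->
          exists U : set (pspace R M),
            [/\ open U, U k & {in U &, injective (@coeff_map R n M)}]].

(* Main.v *)
Require Import Defs.
From mathcomp Require Import all_boot all_order all_algebra.
From mathcomp Require Import all_classical all_reals all_analysis.
From mathcomp Require Import ring lra zify.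

(** Write A for the compartmental matrix, P for its characteristic polynomial
and Q for that of A with its first row and column removed.  With input and
output in the first compartment, the coefficient map records exactly P and Q
([coeff_map_inj]), so the question is how much of the rates P and Q determine.

For generic rates, in each of the three families, P and Q determine the whole
diagonal of A and the product of the rates along every simple directed cycle of
the graph:
- catenary ([tridiagonal_char_poly_inj]): expanding along the first row gives
  P = (X - a_11) Q - k_12 k_21 Q', where Q' belongs to the matrix without its
  first two rows and columns; this is a division of P by Q, so it determines
  a_11, k_12 k_21 and Q', and the argument is repeated with Q and Q';
- mammillary ([arrow_char_poly_inj]): the roots of Q are the diagonal entries
  a_ii other than a_11, and P (a_ii) gives k_1i k_i1;
- cycle ([cyclic_char_poly_inj]): the roots of Q are again the diagonal entries
  other than a_11, and P is the product of all X - a_ii minus the product of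
  all rates.
In the last two cases the roots of Q come without labels.  This is the only
place where identifiability is local rather than global: if the diagonal of A
has distinct entries at a point, then near that point it is labelled by
continuity ([generic_injectivity_identifiable]).

The rates then follow by propagation.  The diagonal entry of a compartment
without leak is minus the sum of its outgoing rates, so it yields the last
unknown one ([rate_last_unknown]); a cycle product yields its last unknown
factor.  In the path and in the star these two steps peel the tree from the
leaves towards the leaking compartment; in the cycle every rate that does not
leave the leaking compartment is read off the diagonal, and the product gives
the remaining one.  The diagonal entry of the leaking compartment is used last
and yields the leak.  The argument works whenever all leaks lie in one
compartment, so it covers the model with its leak and the model without it
([one_leak_identifiable]).

The exceptional parameters are those where some rate vanishes or two diagonal
entries of A coincide.  They form a finite union of hyperplanes, and a
hyperplane is null ([measure_zero_hyperplane]) because a bounded piece of it,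
seen as a Lipschitz graph, is covered by boxes over a grid of mesh h whose
total volume is proportional to h. *)

Set Implicit Arguments.
Unset Strict Implicit.
Unset Printing Implicit Defensive.

Import Order.TTheory GRing.Theory Num.Theory.
Import numFieldNormedType.Exports.

Local Open Scope ring_scope.

(** * Arrow matrices *)

Lemma char_poly_mx_minor (R : nzRingType) n (A : 'M[R]_n.+1) :
  row' 0 (col' 0 (char_poly_mx A)) = char_poly_mx (row' 0 (col' 0 A)).
Proof. by apply/matrixP => i j; rewrite !mxE (inj_eq lift_inj). Qed.

(** Equal products have equal roots as multisets; the hypothesis rules out every
matching of the roots but the identity. *)
Lemma prod_XsubC_inj (F : idomainType) n (a b : 'I_n -> F) :
    (forall i j, i != j -> a i != b j) ->
    \prod_i ('X - (a i)%:P) = \prod_i ('X - (b i)%:P) ->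
  a =1 b.
Proof.
move=> ab eq_prod i.
have : (\prod_i ('X - (b i)%:P)).[a i] == 0.
  rewrite -eq_prod horner_prod; apply/eqP.
  by rewrite (bigD1 i) //= hornerXsubC subrr mul0r.
rewrite horner_prod prodf_seq_eq0 => /hasP[j _] /=.
rewrite !hornerE subr_eq0 => /eqP aibj.
by have [ij|/ab] := eqVneq i j; rewrite aibj ?eqxx // ij.
Qed.

Section Arrow.

(** The Schur complement without division: the block matrix is multiplied on the
right by a lower triangular one that clears the column v and whose determinant
is the product of the d_i, which is then cancelled. *)
Lemma det_arrow_block (R : idomainType) n (x : R) (u : 'rV[R]_n)
    (v : 'cV[R]_n) (d : 'rV[R]_n) : \prod_i d 0 i != 0 ->
  \det (block_mx x%:M u v (diag_mx d)) =
  x * \prod_i d 0 i - \sum_i u 0 i * v i 0 * \prod_(j | j != i) d 0 j.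
Proof.
move=> d_neq0; set S := \sum_i _; set p := \prod_i d 0 i.
(* w is adj(D) v for the diagonal matrix D = diag_mx d *)
pose w := \col_i (v i 0 * \prod_(j | j != i) d 0 j).
pose N := block_mx (p%:M : 'M[R]_1) 0 (- w) (1%:M : 'M[R]_n).
have detN : \det N = p by rewrite det_lblock det1 mulr1 det_scalar expr1.
have uw : u *m w = S%:M.
  rewrite [u *m w]mx11_scalar mxE; congr (_%:M).
  by apply: eq_bigr => i _; rewrite mxE mulrA.
have dw : diag_mx d *m w = p *: v.
  apply/matrixP=> i j; rewrite mul_diag_mx !mxE ord1 /p [in RHS](bigD1 i) //=.
  by rewrite mulrCA mulrC.
apply: (mulIf d_neq0); rewrite -/p -{1}detN -det_mulmx mulmx_block.
rewrite !mulmx0 !mulmx1 !add0r !mulmxN dw uw -scalar_mxM mul_mx_scalar subrr.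
by rewrite det_ublock det_diag -raddfB /= det_scalar1.
Qed.

(** The pattern of the compartmental matrix of a mammillary model. *)
Definition arrow (R : nzRingType) n (A : 'M[R]_n.+1) :=
  forall i j, i != 0 -> j != 0 -> i != j -> A i j = 0.

Variables (F : idomainType) (n : nat).
Implicit Types A B : 'M[F]_n.+1.

Lemma char_poly_arrow_minor A : arrow A ->
  char_poly (row' 0 (col' 0 A)) =
  \prod_i ('X - (A (lift 0 i) (lift 0 i))%:P).
Proof.
move=> arrA; rewrite /char_poly det_trig.
  by apply: eq_bigr => i _; rewrite !mxE eqxx.
apply/is_trig_mxP => i j ij; have neq_ij : i != j by rewrite neq_ltn ij.
by rewrite !mxE (negPf neq_ij) arrA ?subrr // (inj_eq lift_inj).
Qed.

(** In the determinant of an arrow matrix only the identity and the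
transpositions of 0 with another index contribute. *)
Lemma char_poly_arrow A : arrow A ->
  char_poly A =
  ('X - (A 0 0)%:P) * \prod_i ('X - (A (lift 0 i) (lift 0 i))%:P)
  - \sum_i (A 0 (lift 0 i) * A (lift 0 i) 0)%:P
      * \prod_(j | j != i) ('X - (A (lift 0 j) (lift 0 j))%:P).
Proof.
move=> arrA; pose d := \row_i ('X - (A (lift 0 i) (lift 0 i))%:P).
have prod_d (P : pred 'I_n) : \prod_(i | P i) d 0 i =
    \prod_(i | P i) ('X - (A (lift 0 i) (lift 0 i))%:P).
  by apply: eq_bigr => i _; rewrite mxE.
have -> : char_poly A = \det (block_mx ('X - (A 0 0)%:P)%:M
    (\row_i - (A 0 (lift 0 i))%:P) (\col_i - (A (lift 0 i) 0)%:P)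
    (diag_mx d)).
  congr (\det _); rewrite -[LHS](@submxK _ 1 n 1 n).
  congr (@block_mx _ 1 n 1 n _ _ _ _); apply/matrixP=> i j;
    rewrite !mxE ?ord1 /=.
  - by rewrite !lshift0.
  - by rewrite lshift0 rshift1 sub0r.
  - by rewrite lshift0 rshift1 sub0r.
  - rewrite !rshift1 (inj_eq lift_inj); case: eqVneq => [->|ij].
      by rewrite !mulr1n.
    by rewrite arrA ?subrr ?mulr0n // (inj_eq lift_inj).
rewrite det_arrow_block prod_d; last first.
  by apply/prodf_neq0 => i _; rewrite polyXsubC_eq0.
congr (_ - _); apply: eq_bigr => i _.
by rewrite !mxE mulrNN -polyCM prod_d.
Qed.

(** At X = a_ii, i != 0, every term of [char_poly_arrow] vanishes except that of
i, whose last factor is nonzero because the a_jj are distinct; the products of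
opposite entries follow.  Then a_00 is the only unknown left. *)
Lemma arrow_char_poly_inj A B : arrow A -> arrow B ->
    (forall i j, i != j -> A i i != B j j) ->
    char_poly A = char_poly B ->
    char_poly (row' 0 (col' 0 A)) = char_poly (row' 0 (col' 0 B)) ->
  (forall i, A i i = B i i) /\
  (forall i, i != 0 -> A 0 i * A i 0 = B 0 i * B i 0).
Proof.
move=> arrA arrB ABneq eqP; rewrite !char_poly_arrow_minor // => eqQ.
have diag i : A (lift 0 i) (lift 0 i) = B (lift 0 i) (lift 0 i).
  apply: prod_XsubC_inj eqQ i => i j ij.
  by apply: ABneq; rewrite (inj_eq lift_inj).
have sep i j : i != j -> A (lift 0 i) (lift 0 i) != A (lift 0 j) (lift 0 j).
  by move=> ij; rewrite diag eq_sym; rewrite ABneq // (inj_eq lift_inj) eq_sym.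
have evalP C i : arrow C ->
    (forall j, C (lift 0 j) (lift 0 j) = A (lift 0 j) (lift 0 j)) ->
    (char_poly C).[A (lift 0 i) (lift 0 i)] =
    - (C 0 (lift 0 i) * C (lift 0 i) 0 * \prod_(j | j != i)
        (A (lift 0 i) (lift 0 i) - A (lift 0 j) (lift 0 j))).
  move=> arrC CA; rewrite char_poly_arrow // hornerD hornerN hornerM.
  rewrite horner_prod horner_sum.
  rewrite (bigD1 i) //= !hornerXsubC CA subrr mul0r mulr0 add0r; congr (- _).
  rewrite (bigD1 i) //= [X in _ + X]big1 ?addr0 => [|j ji].
    rewrite hornerM hornerC horner_prod; congr (_ * _).
    by apply: eq_bigr => j _; rewrite hornerXsubC CA.
  rewrite hornerM horner_prod (bigD1 i) 1?eq_sym //= hornerXsubC CA subrr.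
  by rewrite mul0r mulr0.
have prod i : A 0 (lift 0 i) * A (lift 0 i) 0 = B 0 (lift 0 i) * B (lift 0 i) 0.
  have := evalP B i arrB (fun j => esym (diag j)).
  rewrite -eqP evalP // => /oppr_inj; apply: mulIf.
  by apply/prodf_neq0 => j ji; rewrite subr_eq0 sep // eq_sym.
split=> i; last by case: (unliftP 0 i) => [j ->|->]; rewrite ?eqxx.
case: (unliftP 0 i) => [j ->//|->].
move: eqP; rewrite !char_poly_arrow // eqQ.
under [X in _ - X = _]eq_bigr => j _.
  rewrite prod; under eq_bigr => j' _ do rewrite diag.
  over.
move/addIr/mulIf => H; apply/polyC_inj/oppr_inj/(addrI 'X)/H.
by apply/prodf_neq0 => j _; rewrite polyXsubC_eq0.
Qed.

End Arrow.

(** * Cyclic matrices *)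

Section Cyclic.

(** The pattern of the compartmental matrix of a cycle model: off the diagonal,
column j is supported on the row of the successor of j. *)
Definition cyclic (R : nzRingType) n (A : 'M[R]_n.+1) :=
  forall i j : 'I_n.+1, j != i -> (i != j.+1 %% n.+1 :> nat)%N -> A i j = 0.

Lemma cyclic_minor_trig (R : nzRingType) n (A : 'M[R]_n.+1) : cyclic A ->
  is_trig_mx (row' 0 (col' 0 A)).
Proof.
move=> cycA; apply/is_trig_mxP=> i j ij.
rewrite !mxE cycA //; first by rewrite (inj_eq lift_inj) neq_ltn ij orbT.
rewrite /= /bump /= !add1n; have [jn|jn] := ltnP j.+2 n.+1.
  by rewrite modn_small // neq_ltn !ltnS (ltnW ij).
have /eqP -> : j.+2 == n.+1 by rewrite eqn_leq jn ltnS ltn_ord.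
by rewrite modnn.
Qed.

(** Along the first row only the entries in columns 0 and n + 1 can be nonzero;
their minors are a lower and an upper triangular matrix. *)
Lemma det_cyclic (R : comNzRingType) n (A : 'M[R]_n.+2) : cyclic A ->
  \det A = \prod_i A i i
    + (-1) ^+ n.+1 * (A 0 ord_max
        * \prod_(i < n.+1) A (lift 0 i) (widen_ord (leqnSn _) i)).
Proof.
move=> cycA; rewrite (expand_det_row A 0) (bigD1 0) //= (bigD1 ord_max) //=.
rewrite [X in _ + (_ + X)]big1 ?addr0 => [|j /andP[j0 jm]]; last first.
  rewrite cycA ?mul0r // modn_small // ltnS ltn_neqAle -ltnS ltn_ord andbT.
  exact: jm.
rewrite [in RHS]big_ord_recl /cofactor addn0 expr0 mul1r.
rewrite det_trig ?cyclic_minor_trig //; congr (_ + _).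
  by congr (_ * _); apply: eq_bigr => i _; rewrite !mxE.
rewrite add0n mulrCA; congr (_ * (_ * _)); rewrite -det_tr det_trig.
  apply: eq_bigr => i _; rewrite !mxE; congr (A _ _).
  by apply: val_inj; rewrite /= /bump leqNgt ltn_ord.
apply/is_trig_mxP=> i j ij.
rewrite !mxE cycA // -?val_eqE /= /bump /= leqNgt ltn_ord /= add0n add1n.
  by rewrite neq_ltn ltnS (ltnW ij).
rewrite modn_small; last by rewrite ltnS; exact: (ltn_ord i).
by rewrite neq_ltn !ltnS ij orbT.
Qed.

Variables (F : idomainType) (n : nat).
Implicit Types A B : 'M[F]_n.+2.

Lemma char_poly_mx_cyclic A : cyclic A -> cyclic (char_poly_mx A).
Proof.
move=> cycA i j ji ij; rewrite !mxE cycA // eq_sym (negPf ji).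
by rewrite mulr0n subr0.
Qed.

Lemma char_poly_cyclic A : cyclic A ->
  char_poly A = \prod_i ('X - (A i i)%:P)
    - (A 0 ord_max
       * \prod_(i < n.+1) A (lift 0 i) (widen_ord (leqnSn _) i))%:P.
Proof.
move=> cycA; rewrite /char_poly det_cyclic; last exact: char_poly_mx_cyclic.
congr (_ + _); first by apply: eq_bigr => i _; rewrite !mxE eqxx.
rewrite !mxE /= sub0r.
have -> : \prod_(i < n.+1) char_poly_mx A (lift 0 i) (widen_ord (leqnSn _) i)
    = (-1) ^+ n.+1
      * (\prod_(i < n.+1) A (lift 0 i) (widen_ord (leqnSn _) i))%:P.
  rewrite rmorph_prod -[in (-1) ^+ _](card_ord n.+1) -prodrN.
  apply: eq_bigr => i _; rewrite !mxE.
  by rewrite -val_eqE /= /bump /= add1n eqn_leq ltnn sub0r.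
by rewrite mulrCA signrMK polyCM mulNr.
Qed.

Lemma prod_cycle A :
  A 0 ord_max * \prod_(i < n.+1) A (lift 0 i) (widen_ord (leqnSn _) i) =
  \prod_j A (ordS j) j.
Proof.
rewrite [RHS]big_ord_recr mulrC; congr (_ * A _ _).
  apply: eq_bigr => i _; congr (A _ _); apply: val_inj => /=.
  by rewrite modn_small // ltnS.
by apply: val_inj; rewrite /= modnn.
Qed.

(** By [char_poly_cyclic], evaluating the characteristic polynomial at a
diagonal entry other than a_00 leaves only the product of the entries around
the cycle; a_00 is recovered afterwards. *)
Lemma cyclic_char_poly_inj A B : cyclic A -> cyclic B ->
    (forall i j, i != j -> A i i != B j j) ->
    char_poly A = char_poly B ->
    char_poly (row' 0 (col' 0 A)) = char_poly (row' 0 (col' 0 B)) ->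
  (forall i, A i i = B i i) /\ \prod_j A (ordS j) j = \prod_j B (ordS j) j.
Proof.
move=> cycA cycB ABneq eqP eqQ; rewrite -!prod_cycle.
have minorQ (C : 'M[F]_n.+2) : cyclic C -> char_poly (row' 0 (col' 0 C)) =
    \prod_i ('X - (C (lift 0 i) (lift 0 i))%:P).
  move=> cycC; rewrite /char_poly -char_poly_mx_minor.
  rewrite det_trig; last exact/cyclic_minor_trig/char_poly_mx_cyclic.
  by apply: eq_bigr => i _; rewrite !mxE eqxx.
move: eqQ; rewrite !minorQ // => eqQ.
have diag i : A (lift 0 i) (lift 0 i) = B (lift 0 i) (lift 0 i).
  apply: prod_XsubC_inj eqQ i => i j ij.
  by apply: ABneq; rewrite (inj_eq lift_inj).
have eqE : A 0 ord_max * \prod_(i < n.+1) A (lift 0 i) (widen_ord (leqnSn _) i)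
    = B 0 ord_max * \prod_(i < n.+1) B (lift 0 i) (widen_ord (leqnSn _) i).
  have evalP (C : 'M[F]_n.+2) : cyclic C ->
      C (lift 0 0) (lift 0 0) = A (lift 0 0) (lift 0 0) ->
      (char_poly C).[A (lift 0 0) (lift 0 0)] =
      - (C 0 ord_max
         * \prod_(i < n.+1) C (lift 0 i) (widen_ord (leqnSn _) i)).
    move=> cycC CA; rewrite char_poly_cyclic // hornerD hornerN hornerC.
    by rewrite horner_prod (bigD1 (lift 0 0)) //= !hornerE CA subrr mul0r add0r.
  by apply: oppr_inj; rewrite -!evalP // eqP.
split=> // i; case: (unliftP 0 i) => [j ->//|->].
move: eqP; rewrite !char_poly_cyclic // eqE => /addIr.
rewrite !(big_ord_recl n.+1) /= eqQ => /mulIf H.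
apply/polyC_inj/oppr_inj/(addrI 'X)/H.
by apply/prodf_neq0 => j _; rewrite polyXsubC_eq0.
Qed.

End Cyclic.

(** * Tridiagonal matrices *)

Section Tridiagonal.

(** Tridiagonal matrices are taken as functions on pairs of naturals, so that
the trailing blocks of a matrix are blocks of the same function. *)
Definition tridiagonal (R : nmodType) (f : nat -> nat -> R) :=
  forall i j, (i.+1 < j)%N || (j.+1 < i)%N -> f i j = 0.

Definition block_of (R : Type) (f : nat -> nat -> R) s n : 'M[R]_n :=
  \matrix_(i, j) f (s + i)%N (s + j)%N.

Lemma det_tridiagonal (R : comNzRingType) (f : nat -> nat -> R) s n :
    tridiagonal f ->
  \det (block_of f s n.+2) =
  f s s * \det (block_of f s.+1 n.+1)
  - f s s.+1 * f s.+1 s * \det (block_of f s.+2 n).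
Proof.
move=> tri; rewrite (expand_det_row _ 0) !big_ord_recl big1 ?addr0; last first.
  by move=> i _; rewrite mxE tri ?mul0r // !addnS !ltnS leq_add2l.
rewrite !mxE /= !addn0 addn1 /cofactor expr0 mul1r expr1 mulN1r mulrN.
congr (_ * \det _ - _); first by apply/matrixP=> i j; rewrite !mxE !addnS.
rewrite -mulrA (expand_det_col _ 0) big_ord_recl big1 ?addr0; last first.
  move=> i _; rewrite !mxE /= tri ?mul0r // !addn0 !addnS !ltnS.
  by rewrite leq_addr orbT.
rewrite !mxE /= !addn0 addn1 /cofactor expr0 mul1r; congr (_ * (_ * \det _)).
by apply/matrixP=> i j; rewrite !mxE !addnS.
Qed.

Variable F : idomainType.
Implicit Types f g : nat -> nat -> F.

Lemma char_poly_tridiagonal f s n : tridiagonal f ->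
  char_poly (block_of f s n.+2) =
  ('X - (f s s)%:P) * char_poly (block_of f s.+1 n.+1)
  - (f s s.+1 * f s.+1 s)%:P * char_poly (block_of f s.+2 n).
Proof.
move=> tri; pose h i j := 'X *+ (i == j) - (f i j)%:P.
have cpE t m : char_poly (block_of f t m) = \det (block_of h t m).
  by congr (\det _); apply/matrixP=> i j; rewrite !mxE /h eqn_add2l.
rewrite !cpE det_tridiagonal => [|i j ij]; last first.
  rewrite /h tri // subr0 (_ : i == j = false) //.
  by case: eqVneq ij => // ->; rewrite !ltnNge !leqW.
by rewrite /h !eqxx (ltn_eqF (leqnn s.+1)) (gtn_eqF (leqnn s.+1)) !sub0r mulrNN
           -polyCM.
Qed.

(** Both sides are a division with remainder by P, so quotients and remainders
agree; the remainders are split into leading coefficient and monic part. *)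
Lemma monic_division_inj (a b c d : F) (P Q Q' : {poly F}) :
    P \is monic -> Q \is monic -> Q' \is monic ->
    (size Q < size P)%N -> size Q' = size Q -> c != 0 ->
    ('X - a%:P) * P - c%:P * Q = ('X - b%:P) * P - d%:P * Q' ->
  [/\ a = b, c = d & Q = Q'].
Proof.
move=> mP mQ mQ' QP sQ' c0 eqPQ.
have eq1 : (b - a)%:P * P = c%:P * Q - d%:P * Q'.
  have -> : (b - a)%:P * P = ('X - a%:P) * P - ('X - b%:P) * P.
    by rewrite polyCB; ring.
  by move/(canRL (subrK _)): eqPQ => ->; ring.
have ab : a = b.
  apply/eqP; rewrite eq_sym -subr_eq0; apply/negPn/negP=> ba.
  have : (size (c%:P * Q - d%:P * Q')%R < size P)%N.
    apply: leq_ltn_trans (size_polyD _ _) _; rewrite gtn_max size_polyN.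
    rewrite !mul_polyC (leq_ltn_trans (size_scale_leq _ _)) //.
    by rewrite (leq_ltn_trans (size_scale_leq _ _)) ?sQ'.
  by rewrite -eq1 mul_polyC size_scale // ltnn.
move: eq1; rewrite ab subrr mul0r => /esym/eqP; rewrite subr_eq0 => /eqP eq2.
have cd : c = d.
  have := congr1 lead_coef eq2.
  by rewrite !lead_coefM !lead_coefC (monicP mQ) (monicP mQ') !mulr1.
split=> //; move: eq2; rewrite -cd; apply: mulfI.
by rewrite polyC_eq0.
Qed.

(** The quotient of the characteristic polynomials of two consecutive trailing
blocks is a continued fraction: one step of it reads off a diagonal entry and a
product of opposite entries, and leaves the quotient of the next two blocks.
The products have to be nonzero for the remainder to have the expected
degree. *)
Lemma tridiagonal_char_poly_inj f g s n : tridiagonal f -> tridiagonal g ->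
    (forall i, (i < n)%N ->
       f (s + i)%N (s + i).+1 * f (s + i).+1 (s + i)%N != 0) ->
    char_poly (block_of f s n.+1) = char_poly (block_of g s n.+1) ->
    char_poly (block_of f s.+1 n) = char_poly (block_of g s.+1 n) ->
  (forall i, (i <= n)%N -> f (s + i)%N (s + i)%N = g (s + i)%N (s + i)%N) /\
  (forall i, (i < n)%N -> f (s + i)%N (s + i).+1 * f (s + i).+1 (s + i)%N
                        = g (s + i)%N (s + i).+1 * g (s + i).+1 (s + i)%N).
Proof.
move=> trif trig; elim: n s => [|n IHn] s f_neq0 ePP eQQ.
  split=> // i; rewrite leqn0 => /eqP ->; rewrite !addn0.
  have cp1 (h : nat -> nat -> F) : char_poly (block_of h s 1) = 'X - (h s s)%:P.
    by rewrite /char_poly det_mx11 !mxE !addn0.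
  by move: ePP; rewrite !cp1 => /addrI/oppr_inj/polyC_inj.
move: ePP; rewrite !char_poly_tridiagonal // -eQQ => ePP.
have e0 := f_neq0 0%N isT; rewrite addn0 in e0.
have [||eq_d eq_e eqQ2] := monic_division_inj (char_poly_monic _)
  (char_poly_monic _) (char_poly_monic _) _ _ e0 ePP;
  rewrite ?size_char_poly //.
have [|IHd IHe] := IHn s.+1 _ eQQ eqQ2.
  by move=> i iltn; have := f_neq0 i.+1 iltn; rewrite addnS.
by split=> -[|i] ilt; rewrite ?addn0 ?addnS -?addSn //;
  [apply: IHd | apply: IHe].
Qed.

End Tridiagonal.

(** * Null sets *)

Section NullSets.
Local Open Scope classical_set_scope.
Variable R : realType.

(** Frees the coverings below from explicit enumerations by naturals. *)
Lemma measure_zero_countable_cover N (Z : set 'rV[R]_N) :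
    (forall eps : R, 0 < eps ->
       exists (T : countType) (D : set T) (a b : T -> 'rV[R]_N),
       [/\ forall t i, a t 0 i <= b t 0 i,
           Z `<=` \bigcup_(t in D)
             [set x : 'rV[R]_N | forall i, a t 0 i <= x 0 i <= b t 0 i]
         & (\esum_(t in D) (\prod_i (b t 0 i - a t 0 i))%:E <= eps%:E)%E]) ->
  measure_zero Z.
Proof.
move=> coverZ eps /coverZ [T [D [a [b [ab ZD vol]]]]].
pose ext (h : T -> 'rV[R]_N) m := if unpickle m is Some t then h t else 0.
exists (pickle @` D), (ext a), (ext b); split.
- by move=> m i; rewrite /ext; case: unpickle.
- move=> x /ZD [t Dt tx]; exists (pickle t); first by exists t.
  by rewrite /ext /= pickleK.
- rewrite esum_image; last by move=> s t _ _; apply: (pcan_inj pickleK).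
  by under eq_esum => t _ do rewrite /ext pickleK.
Qed.

(** The boxes for F m are chosen with total volume at most eps / 2 ^ (m + 1). *)
Lemma measure_zero_bigcup N (F : nat -> set 'rV[R]_N) :
  (forall m, measure_zero (F m)) -> measure_zero (\bigcup_m F m).
Proof.
move=> F0; apply: measure_zero_countable_cover => eps eps_gt0.
pose ok m (h : set nat * ((nat -> 'rV[R]_N) * (nat -> 'rV[R]_N))) :=
  [/\ forall t i, h.2.1 t 0 i <= h.2.2 t 0 i,
     F m `<=` \bigcup_(t in h.1)
       [set x : 'rV[R]_N | forall i, h.2.1 t 0 i <= x 0 i <= h.2.2 t 0 i]
   & (\esum_(t in h.1) (\prod_i (h.2.2 t 0 i - h.2.1 t 0 i))%:E
      <= (eps / (2 ^ m.+1)%:R)%:E)%E].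
have /choice[h hP] : forall m, exists h, ok m h.
  move=> m; have [|D [a [b Dab]]] := F0 m (eps / (2 ^ m.+1)%:R).
    by rewrite divr_gt0 // ltr0n expn_gt0.
  by exists (D, (a, b)).
exists (nat * nat)%type, (setT `*`` (fun m => (h m).1)).
exists (fun t => (h t.1).2.1 t.2), (fun t => (h t.1).2.2 t.2); split.
- by move=> [m t] i /=; have [+ _ _] := hP m; apply.
- move=> x [m _ Fx]; have [_ /(_ x Fx)[t Dt tx] _] := hP m.
  by exists (m, t).
- rewrite -(esum_esum (a := fun m t =>
      (\prod_i ((h m).2.2 t 0 i - (h m).2.1 t 0 i))%:E)); last first.
    move=> m t _ _; rewrite lee_fin; apply: prodr_ge0 => i _.
    by rewrite subr_ge0; have [+ _ _] := hP m; apply.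
  apply: (@le_trans _ _
      (\esum_(m in setT) (eps / (2 ^ m.+1)%:R)%:E)%E).
    by apply: le_esum => m _; have [_ _] := hP m.
  rewrite -nneseries_esumT; last first.
    by move=> m; rewrite lee_fin divr_ge0 // ltW.
  have := epsilon_trick (A := fun _ : nat => 0%E) xpredT (fun=> lexx _)
            (ltW eps_gt0).
  rewrite [X in (_ <= X + _)%E -> _]eseries0 // add0e; apply: le_trans.
  by under [X in (_ <= X)%E]eq_eseriesr do rewrite add0e.
Qed.

Lemma measure_zero_sub N (Z Z' : set 'rV[R]_N) :
  Z `<=` Z' -> measure_zero Z' -> measure_zero Z.
Proof.
move=> ZZ' Z'0 eps /Z'0 [D [a [b [ab Z'D vol]]]]; exists D, a, b; split=> //.
exact: subset_trans Z'D.
Qed.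

Lemma measure_zero_set0 N : measure_zero (set0 : set 'rV[R]_N).
Proof.
move=> eps eps_gt0; exists set0, (fun=> 0), (fun=> 0); split=> //.
by rewrite esum_set0 lee_fin ltW.
Qed.

Lemma measure_zero_fin_bigcup N (I : finType) (F : I -> set 'rV[R]_N) :
  (forall i, measure_zero (F i)) -> measure_zero (\bigcup_i F i).
Proof.
move=> F0; pose G m := if unpickle m is Some i then F i else set0.
apply: (@measure_zero_sub _ _ (\bigcup_m G m)).
  by move=> x [i _ Fx]; exists (pickle i) => //; rewrite /G pickleK.
apply: measure_zero_bigcup => m; rewrite /G; case: unpickle => // *.
exact: measure_zero_set0.
Qed.

Lemma esum_finType (T : finType) (a : T -> R) : (forall t, 0 <= a t) ->
  \esum_(t in [set: T]) (a t)%:E = (\sum_t a t)%:E.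
Proof.
move=> a_ge0; rewrite esum_fset; last 2 first.
- exact: finite_finset.
- by move=> t _; rewrite lee_fin.
rewrite (fsbigE (enum T)) ?enum_uniq // => [|t _]; last by rewrite mem_enum.
rewrite big_enum_cond /= sumEFin; congr (_%:E).
by apply: eq_bigl => t; rewrite in_setT.
Qed.

Lemma grid_cell (y h : R) r : 0 <= y <= r.+1%:R * h ->
  exists k : 'I_r.+1, k%:R * h <= y <= k%:R * h + h.
Proof.
elim: r => [|r IHr] /andP[y0 yr].
  by exists ord0; rewrite mul0r add0r y0 -[h]mul1r.
have [yr'|yr'] := leP y (r.+1%:R * h).
  have [|k yk] := IHr; first by rewrite y0.
  by exists (widen_ord (leqnSn _) k).
exists ord_max; rewrite (ltW yr') /=.
by move: yr; rewrite [r.+2%:R]mulrSr mulrDl mul1r.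
Qed.

(** The grid divides [-B, B]^N into (r + 1)^N cubes of side h = 2 B / (r + 1).
Over one cube the linear function varies from its value at the corner by at
most C h, where C is the sum of the |d_i|.  The boxes of height 2 C h have
total volume (2 B)^N * 2 C h, which is V / (r + 1). *)
Lemma measure_zero_bounded_graph N (p : 'I_N.+1) (d : 'I_N -> R) (B : R) :
    0 < B ->
  measure_zero [set x : 'rV[R]_N.+1 |
    x 0 p = \sum_i d i * x 0 (lift p i) /\ forall i, `|x 0 i| <= B].
Proof.
move=> B_gt0; apply: measure_zero_countable_cover => eps eps_gt0.
pose C := \sum_i `|d i|.
have C_ge0 : 0 <= C by apply: sumr_ge0.
pose V := 2 * C * (2 * B) ^+ N.+1.
have V_ge0 : 0 <= V.
  by apply: mulr_ge0; rewrite ?exprn_ge0 // mulr_ge0 // ltW.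
have [r Vr] : exists r, V <= r.+1%:R * eps.
  exists (Num.bound (V / eps)); rewrite -ler_pdivrMr //.
  rewrite (le_trans (ltW (archi_boundP _))) ?ler_nat //.
  by rewrite divr_ge0 // ltW.
pose h := 2 * B / r.+1%:R.
have h_ge0 : 0 <= h by rewrite divr_ge0 // mulr_ge0 // ltW.
have rh : r.+1%:R * h = 2 * B by rewrite mulrCA divff ?mulr1 // pnatr_eq0.
clearbody h.
pose corner (f : {ffun 'I_N -> 'I_r.+1}) i := (f i)%:R * h - B.
pose height f := \sum_i d i * corner f i.
pose a f : 'rV[R]_N.+1 := \row_j
  if unlift p j is Some i then corner f i else height f - C * h.
pose b f : 'rV[R]_N.+1 := \row_j
  if unlift p j is Some i then corner f i + h else height f + C * h.
exists {ffun 'I_N -> 'I_r.+1}, setT, a, b; split.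
- move=> f j; rewrite !mxE; case: unlift => [i|]; first by rewrite lerDl.
  by have := mulr_ge0 C_ge0 h_ge0; lra.
- move=> x [xp xB].
  have /fin_all_exists[f fP] : forall i, exists k : 'I_r.+1,
      k%:R * h <= x 0 (lift p i) + B <= k%:R * h + h.
    move=> i; apply: grid_cell; rewrite rh.
    by have := xB (lift p i); rewrite ler_norml => /andP[]; lra.
  exists (finfun f) => // j /=; rewrite !mxE.
  case: unliftP => [i ->|->].
    by rewrite /corner ffunE; have := fP i; lra.
  have : `|x 0 p - height (finfun f)| <= C * h.
    rewrite xp /height -sumrB mulr_suml (le_trans (ler_norm_sum _ _ _)) //.
    apply: ler_sum => i _; rewrite -mulrBr normrM ler_wpM2l //.
    rewrite /corner ffunE ger0_norm; have := fP i; lra.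
  by rewrite ler_norml; lra.
- have vol f : \prod_j (b f 0 j - a f 0 j) = 2 * C * h * h ^+ N.
    rewrite (bigD1_ord p) //= !mxE unlift_none.
    under eq_bigr => i _ do rewrite !mxE liftK.
    under eq_bigr => i _ do rewrite addrAC subrr add0r.
    by rewrite prodr_const card_ord; congr (_ * _); ring.
  rewrite esum_finType => [|f]; last by rewrite vol !mulr_ge0 // exprn_ge0.
  rewrite lee_fin; under eq_bigr => f _ do rewrite vol.
  rewrite sumr_const card_ffun !card_ord.
  rewrite -(ler_pM2l (ltr0Sn _ r)) (le_trans _ Vr) //.
  rewrite -[X in _ * X <= _]mulr_natl natrX /V -rh exprMn !exprS.
  by rewrite le_eqVlt; apply/orP; left; apply/eqP; ring.
Qed.

Lemma measure_zero_hyperplane N (c : 'I_N -> R) p : c p != 0 ->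
  measure_zero [set x : 'rV[R]_N | \sum_i c i * x 0 i = 0].
Proof.
case: N c p => [c []//|N] c p cp.
pose d i := - (c (lift p i) / c p).
apply: (@measure_zero_sub _ _ (\bigcup_m [set x : 'rV[R]_N.+1 |
    x 0 p = \sum_i d i * x 0 (lift p i) /\ forall i, `|x 0 i| <= m.+1%:R])).
  move=> x /=; rewrite (bigD1_ord p) //= => xc.
  (* every coordinate of x is bounded by the sum of the absolute values *)
  exists (Num.bound (\sum_i `|x 0 i|)) => //=; split=> [|i].
    apply: (mulfI cp); rewrite (canRL (addrK _) xc) sub0r mulr_sumr -sumrN.
    apply: eq_bigr => i _; rewrite /d mulNr mulrN mulrA mulrCA divff //.
    by rewrite mulr1.
  apply: le_trans (_ : \sum_i `|x 0 i| <= _).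
    by rewrite (bigD1 i) //= lerDl sumr_ge0.
  rewrite (le_trans (ltW (archi_boundP _))) ?ler_nat //.
  exact: sumr_ge0.
by apply: measure_zero_bigcup => m; apply: measure_zero_bounded_graph.
Qed.

End NullSets.

(** * Linear forms *)

Section LinearForms.
Local Open Scope classical_set_scope.
Variables (R : realType) (N : nat) (f : 'rV[R]_N -> R).
Hypothesis f_linear : forall (a : R) x y, f (a *: x + y) = a * f x + f y.

Lemma linear_formE x : f x = \sum_q f (delta_mx 0 q) * x 0 q.
Proof.
have fD y z : f (y + z) = f y + f z by rewrite -{1}[y]scale1r f_linear mul1r.
have f0 : f 0 = 0 by apply: (addrI (f 0)); rewrite -fD !addr0.
rewrite {1}[x]row_sum_delta (big_morph f fD f0); apply: eq_bigr => q _.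
by rewrite -[_ *: _]addr0 f_linear f0 addr0 mulrC.
Qed.

Lemma linear_form_continuous : continuous f.
Proof.
rewrite (_ : f = \sum_q (fun x : 'rV[R]_N => f (delta_mx 0 q) * x 0 q));
  last by apply/funext => x; rewrite fct_sumE linear_formE.
apply: (big_ind (fun g : 'rV[R]_N -> R => continuous g)).
- exact: (@cst_continuous _ _ 0).
- by move=> g h g_cont h_cont x; exact: continuousD (g_cont x) (h_cont x).
- by move=> q _ x; exact: (cvgMl_tmp (@coord_continuous R 1 N 0 q x)).
Qed.

Lemma measure_zero_kernel x0 : f x0 != 0 ->
  measure_zero [set x | f x = 0].
Proof.
rewrite linear_formE => fx0.
have [q fq] : exists q, f (delta_mx 0 q) != 0.
  apply/existsP; apply: contraNT fx0 => /existsPn f0.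
  by rewrite big1 // => q _; have /negPn/eqP-> := f0 q; rewrite mul0r.
apply: measure_zero_sub
  (@measure_zero_hyperplane R N (fun q' => f (delta_mx 0 q')) q fq).
by move=> x /=; rewrite linear_formE.
Qed.

End LinearForms.

(** * Rates and the compartmental matrix *)

Section Rates.
Variables (R : realType) (n : nat) (M : model n.+1).
Implicit Types (k : pspace R M) (i j p : 'I_n.+1).

Lemma rate_edge k (e : {e : 'I_n.+1 * 'I_n.+1 | edge M e.1 e.2}) :
  rate k (sval e).2 (sval e).1 = k 0 (enum_rank (inl e : param M)).
Proof.
rewrite /rate -surjective_pairing.
by have -> : insub (sval e) = Some e by exact: valK.
Qed.

Lemma rate_nonedge k i j : ~~ edge M j i -> rate k i j = 0.
Proof. by move=> ji; rewrite /rate insubN. Qed.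

Lemma leak_rate_leak k (l : {j | j \in leaks M}) :
  leak_rate k (sval l) = k 0 (enum_rank (inr l : param M)).
Proof.
rewrite /leak_rate.
by have -> : insub (sval l) = Some l by exact: valK.
Qed.

Lemma leak_rate_nonleak k j : j \notin leaks M -> leak_rate k j = 0.
Proof. by move=> jl; rewrite /leak_rate insubN. Qed.

Lemma rate_neq0 k i j : (forall q, k 0 q != 0) -> edge M i j -> rate k j i != 0.
Proof.
move=> k_neq0 ij; have := rate_edge k (exist _ (i, j) ij) => /= ->.
exact: k_neq0.
Qed.

Lemma rates_inj k k' :
    (forall i j, edge M i j -> rate k j i = rate k' j i) ->
    (forall j, leak_rate k j = leak_rate k' j) ->
  k = k'.
Proof.
move=> eq_rate eq_leak; apply/rowP=> q; rewrite -(enum_valK q).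
case: (enum_val q) => [e|l]; last by rewrite -!leak_rate_leak.
by rewrite -!rate_edge eq_rate //; apply: (valP e).
Qed.

Lemma comp_mx_diag k i :
  comp_mx k i i = - leak_rate k i - \sum_(p | edge M i p) rate k p i.
Proof. by rewrite mxE eqxx. Qed.

Lemma comp_mx_offdiag k i j : i != j -> comp_mx k i j = rate k i j.
Proof. by move=> ij; rewrite mxE (negPf ij). Qed.

Lemma comp_mx_edge k i j : edge M i j -> comp_mx k j i = rate k j i.
Proof.
move=> ij; apply: comp_mx_offdiag; apply: contraTneq ij => ->.
by rewrite edge_irr.
Qed.

Lemma comp_mx_nonedge k i j : i != j -> ~~ edge M i j -> comp_mx k j i = 0.
Proof.
by move=> ij e; rewrite comp_mx_offdiag 1?eq_sym // rate_nonedge.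
Qed.

Lemma comp_mx_diag_linear i (a : R) k k' :
  comp_mx (a *: k + k') i i = a * comp_mx k i i + comp_mx k' i i.
Proof.
have lin_rate p : rate (a *: k + k') p i = a * rate k p i + rate k' p i.
  by rewrite /rate; case: insub => [e|]; rewrite ?mxE ?mulr0 ?addr0.
have lin_leak : leak_rate (a *: k + k') i = a * leak_rate k i + leak_rate k' i.
  by rewrite /leak_rate; case: insub => [e|]; rewrite ?mxE ?mulr0 ?addr0.
rewrite !comp_mx_diag lin_leak; under eq_bigr => p _ do rewrite lin_rate.
by rewrite big_split /= -mulr_sumr; ring.
Qed.

(** The point of an edge leaving i separates the i-th diagonal entry of the
compartmental matrix from all others, which shows that the difference of two
diagonal entries is a nonzero linear form. *)
Definition unit_rate (e : {e : 'I_n.+1 * 'I_n.+1 | edge M e.1 e.2}) :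
  pspace R M := delta_mx 0 (enum_rank (inl e : param M)).

Lemma comp_mx_unit_rate e i :
  comp_mx (unit_rate e) i i = - ((i == (sval e).1)%:R).
Proof.
have rateE p : edge M i p ->
    rate (unit_rate e) p i = (((i, p) : 'I_n.+1 * 'I_n.+1) == sval e)%:R.
  move=> ip; have := rate_edge (unit_rate e) (exist _ (i, p) ip) => /= ->.
  by rewrite mxE eqxx /= (inj_eq enum_rank_inj).
rewrite comp_mx_diag (_ : leak_rate _ i = 0); last first.
  rewrite /leak_rate; case: insub => // l.
  by rewrite mxE eqxx (inj_eq enum_rank_inj).
rewrite oppr0 sub0r; congr (- _); rewrite (eq_bigr _ rateE).
case: e {rateE} => [[a b] ab] /=; have [->|ia] := eqVneq i a.
  rewrite (bigD1 b) //= eqxx big1 ?addr0 // => p /andP[_ pb].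
  by rewrite xpair_eqE (negPf pb) andbF.
by rewrite big1 // => p _; rewrite xpair_eqE (negPf ia).
Qed.

Lemma last_rate k k' i p :
    leak_rate k i = leak_rate k' i -> comp_mx k i i = comp_mx k' i i ->
    edge M i p ->
    (forall p', edge M i p' -> p' != p -> rate k p' i = rate k' p' i) ->
  rate k p i = rate k' p i.
Proof.
move=> eq_leak; rewrite !comp_mx_diag eq_leak => /addrI/oppr_inj + ip eq_rate.
rewrite (bigD1 p) // [RHS](bigD1 p) //= (eq_bigr (fun p' => rate k' p' i)).
  by move/addIr.
by move=> p' /andP[]; apply: eq_rate.
Qed.

Lemma params_inj k k' : (forall i, comp_mx k i i = comp_mx k' i i) ->
    (forall i j, edge M i j -> rate k j i = rate k' j i) ->
  k = k'.
Proof.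
move=> eq_diag eq_rate; apply: rates_inj => // j.
have := eq_diag j; rewrite !comp_mx_diag (eq_bigr (fun p => rate k' p j)).
  by move/addIr/oppr_inj.
by move=> p; apply: eq_rate.
Qed.

(** The omitted coefficients are constant functions of the parameters, so
equality of the recorded ones is equality of the two polynomials. *)
Lemma coeff_map_inj k k' : inputs M = [set ord0]%SET ->
    outputs M = [set ord0]%SET -> coeff_map k = coeff_map k' ->
  char_poly (comp_mx k) = char_poly (comp_mx k') /\
  char_poly (row' 0 (col' 0 (comp_mx k))) =
  char_poly (row' 0 (col' 0 (comp_mx k'))).
Proof.
move=> inM outM eq_map.
have eq_coeff t : in_equations M t -> coeff k t = coeff k' t.
  move=> eqt; have [tS|] := boolP (t \in coeff_terms R M).
    have := congr1 (fun u : 'rV_ _ => u 0 (enum_rank_in tS t)) eq_map.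
    by rewrite !mxE enum_rankK_in.
  rewrite inE eqt /= => /asboolPn/not_andP[] /contrapT eqc; by rewrite !eqc.
have poly_eq m (P Q : {poly R}) : (size P <= m)%N -> (size Q <= m)%N ->
    (forall d : 'I_m, P`_d = Q`_d) -> P = Q.
  move=> sP sQ eqPQ; apply/polyP=> d; have [dm|md] := ltnP d m.
    exact: eqPQ (Ordinal dm).
  by rewrite !nth_default // (leq_trans _ md).
split.
  apply: (@poly_eq n.+2) => [||d]; rewrite ?size_char_poly //.
  by apply: (eq_coeff (ord0, None, d)); rewrite /= outM inE eqxx.
apply: (@poly_eq n.+2) => [||d]; rewrite ?size_char_poly ?leqnSn //.
have := eq_coeff (ord0, Some ord0, d).
rewrite /= inM outM !inE eqxx => /(_ isT).
by rewrite /rhs_op addn0 expr0 !mul1r /char_poly -!char_poly_mx_minor.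
Qed.

End Rates.

(** * Generic parameters *)

Section Genericity.
Local Open Scope classical_set_scope.
Variables (R : realType) (n : nat) (M : model n.+1).

Lemma separation_gap (a : 'I_n.+1 -> R) :
    (forall i j, i != j -> a i != a j) ->
  exists2 e : R, 0 < e & forall i j, i != j -> e + e <= `|a i - a j|.
Proof.
move=> a_inj; pose gap := \big[Num.min/1]_(t : 'I_n.+1 * 'I_n.+1 | t.1 != t.2)
  `|a t.1 - a t.2|.
have gap_gt0 : 0 < gap.
  apply: lt_bigmin => // -[i j] /= ij.
  by rewrite normr_gt0 subr_eq0 a_inj.
exists (gap / 2); first by rewrite divr_gt0.
move=> i j ij; rewrite -splitr.
exact: (bigmin_le_cond _ _ (j := (i, j))).
Qed.

(** It suffices to prove injectivity for two points k and k' such that the i-th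
diagonal entry at k differs from the j-th at k' for i != j.  Off the exceptional
hyperplanes this holds on a neighbourhood where each diagonal entry moves by
less than half the smallest gap between two of them. *)
Lemma generic_injectivity_identifiable :
    strongly_connected M -> inputs M != finset.set0 ->
    (forall k k' : pspace R M, coeff_map k = coeff_map k' ->
       (forall q, k 0 q != 0) ->
       (forall i j, i != j -> comp_mx k i i != comp_mx k' j j) -> k = k') ->
  gen_loc_identifiable R M.
Proof.
move=> conn in_neq0 injM; split=> //.
pose zero_rate q := [set k : pspace R M | k 0 q = 0].
pose same_diag (t : 'I_n.+1 * 'I_n.+1) := if t.1 == t.2 then set0 else
  [set k : pspace R M | comp_mx k t.1 t.1 - comp_mx k t.2 t.2 = 0].
pose bad (s : ('I_#|param M| + 'I_n.+1 * 'I_n.+1)%type) :=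
  match s with inl q => zero_rate q | inr t => same_diag t end.
exists (\bigcup_s bad s); split.
  apply: measure_zero_fin_bigcup => -[q|[i j]] /=.
    apply: (@measure_zero_kernel R _ (fun k => k 0 q) _ (delta_mx 0 q)).
      by move=> a x y; rewrite !mxE.
    by rewrite mxE !eqxx oner_eq0.
  rewrite /same_diag /=; have [_|ij] := eqVneq i j.
    exact: measure_zero_set0.
  have [p ip] : exists p, edge M i p.
    have /connectP[[|p s] /= + ji] := conn i j; first by rewrite ji eqxx in ij.
    by case/andP=> ip _; exists p.
  apply: (@measure_zero_kernel R _
    (fun k : pspace R M => comp_mx k i i - comp_mx k j j) _
    (unit_rate R (exist _ (i, p) ip))).
    by move=> a x y; rewrite !comp_mx_diag_linear; ring.
  rewrite !comp_mx_unit_rate /= eqxx [j == i]eq_sym (negPf ij) oppr0 subr0.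
  by rewrite oppr_eq0 oner_eq0.
move=> k0 good.
have k0_neq0 q : k0 0 q != 0.
  by apply/eqP => k0q; apply: good; exists (inl q).
have k0_sep i j : i != j -> comp_mx k0 i i != comp_mx k0 j j.
  move=> ij; rewrite -subr_eq0; apply/eqP => k0ij; apply: good.
  by exists (inr (i, j)) => //=; rewrite /same_diag /= (negPf ij).
have [e e_gt0 gap] := separation_gap k0_sep.
pose V := [set k : pspace R M | (forall q, k 0 q != 0) /\
  forall i, `|comp_mx k0 i i - comp_mx k i i| < e].
have V_k0 : nbhs k0 V.
  have near_neq0 : nbhs k0 [set k : pspace R M | forall q, k 0 q != 0].
    apply: (@filter_forall (pspace R M) _ _ (nbhs k0)) => q.
    apply: cvgr_neq0 (k0_neq0 q).
    exact: (@coord_continuous R 1 _ 0 q).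
  have near_diag : nbhs k0 [set k : pspace R M |
      forall i, `|comp_mx k0 i i - comp_mx k i i| < e].
    apply: (@filter_forall (pspace R M) _ _ (nbhs k0)) => i.
    apply: cvgr_dist_lt e_gt0.
    by apply: linear_form_continuous => a x y; apply: comp_mx_diag_linear.
  exact: filterI near_neq0 near_diag.
exists V^°; split; first exact: open_interior.
  exact: V_k0.
move=> k k'; rewrite !inE => /interior_subset[k_neq0 kk0].
move=> /interior_subset[_ k'k0] eq_map; apply: injM => // i j ij.
apply/eqP => kij; have := gap i j ij; apply/negP; rewrite -ltNge.
have -> : comp_mx k0 i i - comp_mx k0 j j =
  (comp_mx k0 i i - comp_mx k i i) - (comp_mx k0 j j - comp_mx k' j j).
  by rewrite kij; ring.
by apply: le_lt_trans (ler_normB _ _) _; apply: ltrD.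
Qed.

End Genericity.

(** * Recovering the rates *)

Section Identification.
Variables (R : realType) (n : nat) (M : model n.+1) (l : 'I_n.+1).
Hypothesis leak_at : leaks M \subset [set l]%SET.
Implicit Types (k : pspace R M) (i j p : 'I_n.+1).

Lemma leak_rate_away k i : i != l -> leak_rate k i = 0.
Proof.
move=> il; apply: leak_rate_nonleak.
apply: contra il => /(fintype.subsetP leak_at).
by rewrite inE.
Qed.

Lemma rate_last_unknown k k' i p :
    i != l -> comp_mx k i i = comp_mx k' i i -> edge M i p ->
    (forall p', edge M i p' -> p' != p -> rate k p' i = rate k' p' i) ->
  rate k p i = rate k' p i.
Proof. by move=> il; apply: last_rate; rewrite !leak_rate_away. Qed.

Lemma rate_of_product k k' i j : edge M j i ->
    (forall q, k 0 q != 0) -> rate k i j = rate k' i j ->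
    rate k i j * rate k j i = rate k' i j * rate k' j i ->
  rate k j i = rate k' j i.
Proof. by move=> ji k_neq0 <-; apply/mulfI/rate_neq0. Qed.

Section TwoParameters.
Variables k k' : pspace R M.
Hypothesis k_neq0 : forall q, k 0 q != 0.
Hypothesis eq_char : char_poly (comp_mx k) = char_poly (comp_mx k').
Hypothesis eq_char_minor : char_poly (row' 0 (col' 0 (comp_mx k))) =
  char_poly (row' 0 (col' 0 (comp_mx k'))).
Hypothesis sep : forall i j, i != j -> comp_mx k i i != comp_mx k' j j.

(** A compartment i != 0 has a single outgoing edge; without a leak at i, its
diagonal entry gives the rate to 0, and the product the rate back.  If the leak
is at i != 0, the diagonal entry of 0 then gives the rate from 0 to i as its
last unknown, and the product again gives the opposite rate. *)
Lemma mammillary_params_inj : mammillary M -> k = k'.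
Proof.
move=> mam.
have edge0 i : i != 0 -> edge M i 0 /\ edge M 0 i.
  by move=> i0; rewrite !mam eqxx (i0 : _ != 0%N :> nat) orbT.
have edgeE i j : edge M i j -> (i = 0 /\ j != 0) \/ (j = 0 /\ i != 0).
  rewrite mam => /orP[]/andP[/eqP i0 j0]; [left|right]; split=> //;
  exact: val_inj.
have arr (k1 : pspace R M) : arrow (comp_mx k1).
  move=> i j i0 j0 ij; rewrite comp_mx_nonedge 1?eq_sym //.
  by apply/negP => /edgeE[] [] /eqP; rewrite ?(negPf i0) ?(negPf j0).
have [diag prod] :=
  arrow_char_poly_inj (arr k) (arr k') sep eq_char eq_char_minor.
have prodE i : i != 0 -> rate k 0 i * rate k i 0 = rate k' 0 i * rate k' i 0.
  move=> i0; have [e1 e2] := edge0 i i0.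
  by have := prod i i0; rewrite !comp_mx_edge.
have away i : i != 0 -> i != l ->
    rate k 0 i = rate k' 0 i /\ rate k i 0 = rate k' i 0.
  move=> i0 il; have [e1 e2] := edge0 i i0.
  have eq1 : rate k 0 i = rate k' 0 i.
    apply: rate_last_unknown => // p /edgeE[[i0']|[->]]; last by rewrite eqxx.
    by rewrite i0' eqxx in i0.
  by split=> //; apply: rate_of_product (prodE i i0).
have all i : i != 0 -> rate k 0 i = rate k' 0 i /\ rate k i 0 = rate k' i 0.
  move=> i0; have [il|/away] := eqVneq i l; last exact.
  have [e1 e2] := edge0 i i0.
  have eq1 : rate k i 0 = rate k' i 0.
    apply: rate_last_unknown => //; first by rewrite -il eq_sym.
    move=> p /edgeE[[_ p0]|[]]; last by rewrite eqxx.
    by rewrite il => /(away p p0)[].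
  by split=> //; apply: rate_of_product; rewrite // mulrC prodE // mulrC.
apply: params_inj => // i j /edgeE[[-> /all[]]|[-> /all[]]] //.
Qed.

(** The rates are recovered from both ends of the path towards the leak: [up]
goes through the edges before l and [down] through those after it. *)
Lemma catenary_params_inj : catenary M -> k = k'.
Proof.
move=> cat.
(* extended by 0, so that the tridiagonal pattern holds at all naturals *)
pose f (k1 : pspace R M) (i j : nat) : R :=
  if (i <= n)%N && (j <= n)%N then comp_mx k1 (inord i) (inord j) else 0.
have fE k1 i j : f k1 i j = comp_mx k1 i j.
  by rewrite /f -ltnS ltn_ord -ltnS ltn_ord !inord_val.
have tri k1 : tridiagonal (f k1).
  move=> i j ij; rewrite /f; case: ifP => // /andP[i_le j_le].
  have ji : (j.+1 < i)%N || (i.+1 < j)%N by rewrite orbC.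
  rewrite comp_mx_nonedge // ?cat -?val_eqE /= !inordK //; first by lia.
  by apply/negP => /orP[]/eqP; lia.
have blockE k1 : block_of (f k1) 0 n.+1 = comp_mx k1.
  by apply/matrixP=> i j; rewrite mxE fE.
have block1E k1 : block_of (f k1) 1 n = row' 0 (col' 0 (comp_mx k1)).
  by apply/matrixP=> i j; rewrite !mxE -[(1 + i)%N]/(nat_of_ord (lift ord0 i))
    -[(1 + j)%N]/(nat_of_ord (lift ord0 j)) fE mxE.
have edgeS i j : j = i.+1 :> nat -> edge M i j /\ edge M j i.
  by move=> ij; rewrite !cat ij eqxx orbT.
have [|||diag prod] :=
  @tridiagonal_char_poly_inj _ (f k) (f k') 0 n (tri k) (tri k').
- move=> i i_lt; rewrite add0n.
  have /edgeS[e1 e2] : (inord i.+1 : 'I_n.+1) = (inord i : 'I_n.+1).+1 :> nat.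
    by rewrite !inordK ?ltnS // ltnW.
  rewrite /f i_lt ltnW //= !comp_mx_edge // mulf_neq0 //; exact: rate_neq0.
- by rewrite !blockE.
- by rewrite !block1E.
have diagE i : comp_mx k i i = comp_mx k' i i.
  by rewrite -!fE; apply: (diag i); rewrite -ltnS.
have prodE i j : j = i.+1 :> nat ->
    rate k j i * rate k i j = rate k' j i * rate k' i j.
  move=> ij; have [e1 e2] := edgeS i j ij.
  rewrite -!comp_mx_edge // -!fE ij ![f _ i.+1 i * _]mulrC.
  by apply: (prod i); rewrite -ltnS -ij.
have up m i j : i = m :> nat -> j = i.+1 :> nat -> (i < l)%N ->
    rate k j i = rate k' j i /\ rate k i j = rate k' i j.
  elim: m i j => [|m IHm] i j im ij il; have [e1 e2] := edgeS i j ij.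
    have eq1 : rate k j i = rate k' j i.
      apply: rate_last_unknown => //; first by rewrite neq_ltn il.
      move=> p; rewrite cat im orbF => /eqP p1; rewrite -val_eqE /=.
      by rewrite p1 ij im eqxx.
    by split=> //; apply: rate_of_product (prodE i j ij).
  have eq1 : rate k j i = rate k' j i.
    apply: rate_last_unknown => //; first by rewrite neq_ltn il.
    move=> p; rewrite cat -ij => /orP[/eqP/val_inj-> /eqP//|/eqP ip _].
    have [|||_ //] := IHm p i; lia.
  by split=> //; apply: rate_of_product (prodE i j ij).
have down m i j : (n - j = m)%N -> j = i.+1 :> nat -> (l < j)%N ->
    rate k j i = rate k' j i /\ rate k i j = rate k' i j.
  elim/ltn_ind: m i j => m IHm i j jm ij lj; have [e1 e2] := edgeS i j ij.
  have eq1 : rate k i j = rate k' i j.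
    apply: rate_last_unknown => //; first by rewrite neq_ltn lj orbT.
    move=> p; rewrite cat ij eqSS => /orP[/eqP pj _|].
      have p_lt := ltn_ord p.
      have [||||-> _ //] := IHm (n - p)%N _ j p; lia.
    by move=> /eqP/val_inj-> /eqP.
  by split=> //; apply: rate_of_product; rewrite // mulrC prodE // mulrC.
have all i j : j = i.+1 :> nat ->
    rate k j i = rate k' j i /\ rate k i j = rate k' i j.
  move=> ij; have [il|li] := ltnP i l; first exact: (up i i j erefl ij il).
  by apply: (down (n - j)%N i j erefl ij); rewrite ij ltnS.
by apply: params_inj => // i j; rewrite cat => /orP[]/eqP/all[].
Qed.

End TwoParameters.
End Identification.

(** A compartment without leak has its only outgoing rate on the diagonal; the
product around the cycle gives the rate out of l. *)
Lemma cycle_params_inj (R : realType) n (M : model n.+2) (l : 'I_n.+2)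
    (k k' : pspace R M) :
    leaks M \subset [set l]%SET -> (forall q, k 0 q != 0) ->
    char_poly (comp_mx k) = char_poly (comp_mx k') ->
    char_poly (row' 0 (col' 0 (comp_mx k))) =
    char_poly (row' 0 (col' 0 (comp_mx k'))) ->
    (forall i j, i != j -> comp_mx k i i != comp_mx k' j j) ->
  cycle_model M -> k = k'.
Proof.
move=> leak_at k_neq0 eq_char eq_char_minor sep [_ cyc].
have edgeE (i j : 'I_n.+2) : edge M i j = (j == ordS i) by rewrite cyc -val_eqE.
have cyclicM (k1 : pspace R M) : cyclic (comp_mx k1).
  by move=> i j ji ij; rewrite comp_mx_nonedge // edgeE -val_eqE.
have [diag prod] :=
  cyclic_char_poly_inj (cyclicM k) (cyclicM k') sep eq_char eq_char_minor.
have prodE : \prod_j rate k (ordS j) j = \prod_j rate k' (ordS j) j.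
  have prod_rate (k1 : pspace R M) :
      \prod_j comp_mx k1 (ordS j) j = \prod_j rate k1 (ordS j) j.
    by apply: eq_bigr => j _; rewrite comp_mx_edge // edgeE.
  by rewrite -!prod_rate.
have away j : j != l -> rate k (ordS j) j = rate k' (ordS j) j.
  move=> jl; apply: (rate_last_unknown leak_at jl (diag j)).
    by rewrite edgeE.
  by move=> p; rewrite edgeE => ->.
apply: params_inj => // i j; rewrite edgeE => /eqP ->.
have [->|/away//] := eqVneq i l.
move: prodE; rewrite (bigD1 l) // [RHS](bigD1 l) //=.
rewrite (eq_bigr (fun j => rate k' (ordS j) j)) => [|p /away //].
apply: mulIf; apply/prodf_neq0 => p /away <-.
by apply: rate_neq0; rewrite ?edgeE.
Qed.

(** * Strong connectedness *)

Section Connectedness.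
Variable n : nat.
Implicit Types M : model n.+1.

Lemma catenary_connected M : catenary M -> strongly_connected M.
Proof.
move=> cat.
have step (i j : 'I_n.+1) : j = i.+1 :> nat ->
    connect (edge M) i j /\ connect (edge M) j i.
  by move=> ij; split; apply: connect1; rewrite cat ij eqxx ?orbT.
have from0 m (i : 'I_n.+1) : i = m :> nat ->
    connect (edge M) ord0 i /\ connect (edge M) i ord0.
  elim: m i => [|m IHm] i im.
    have -> : i = ord0 by apply: val_inj.
    by split; apply: connect0.
  have m_lt : (m < n.+1)%N by rewrite ltnW // -im.
  have [c1 c2] := IHm (Ordinal m_lt) erefl.
  have [|c3 c4] := step (Ordinal m_lt) i; first by rewrite im.
  by split; [apply: connect_trans c1 c3 | apply: connect_trans c4 c2].
move=> i j; have [_ c1] := from0 i i erefl; have [c2 _] := from0 j j erefl.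
exact: connect_trans c1 c2.
Qed.

Lemma mammillary_connected M : mammillary M -> strongly_connected M.
Proof.
move=> mam; have hub (i : 'I_n.+1) :
    connect (edge M) ord0 i /\ connect (edge M) i ord0.
  have [->|i0] := eqVneq i ord0; first by split; apply: connect0.
  have {}i0 : i != 0%N :> nat by [].
  by split; apply: connect1; rewrite mam i0 ?orbT.
move=> i j; have [_ c1] := hub i; have [c2 _] := hub j.
exact: connect_trans c1 c2.
Qed.

Lemma cycle_connected M : cycle_model M -> strongly_connected M.
Proof.
move=> [_ cyc].
have walk (d : nat) (i j : 'I_n.+1) :
    j = ((i + d) %% n.+1)%N :> nat -> connect (edge M) i j.
  elim: d j => [|d IHd] j ij.
    have -> : j = i by apply: val_inj; rewrite /= ij addn0 modn_small.
    exact: connect0.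
  have lt_mod : ((i + d) %% n.+1 < n.+1)%N by rewrite ltn_mod.
  apply: connect_trans (IHd (Ordinal lt_mod) erefl) (connect1 _).
  by rewrite cyc ij /= -[in X in _ == X]addn1 modnDml addn1 addnS.
move=> i j; apply: (walk (n.+1 - i + j)%N); rewrite addnA subnKC 1?ltnW //.
by rewrite modnDl modn_small.
Qed.

End Connectedness.

(** * Identifiability *)

Lemma one_leak_identifiable (R : realType) n (M : model n.+1) (l : 'I_n.+1) :
    catenary M \/ cycle_model M \/ mammillary M ->
    inputs M = [set ord0]%SET -> outputs M = [set ord0]%SET ->
    leaks M \subset [set l]%SET ->
  gen_loc_identifiable R M.
Proof.
move=> graphM inM outM leakM.
apply: generic_injectivity_identifiable.
- case: graphM => [/catenary_connected //|[/cycle_connected //|]].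
  exact: mammillary_connected.
- by rewrite inM; apply/set0Pn; exists ord0; rewrite inE.
move=> k k' /(coeff_map_inj inM outM)[eq_char eq_minor].
move=> k_neq0 sep.
case: graphM => [cat|[cyc|mam]].
- exact: (catenary_params_inj leakM k_neq0 eq_char eq_minor).
- case: n => [|n'] in M l inM outM leakM k k' eq_char eq_minor k_neq0 sep cyc *.
    by case: cyc.
  exact: (cycle_params_inj leakM k_neq0 eq_char eq_minor sep).
- exact: (mammillary_params_inj leakM k_neq0 eq_char eq_minor sep).
Qed.

Theorem theorem3p2 (R : realType) (n : nat) (M : model n.+1)
  (graphM : catenary M \/ cycle_model M \/ mammillary M)
  (inM : inputs M = [set ord0]%SET)
  (outM : outputs M = [set ord0]%SET)
  (leakM : #|leaks M| = 1%N) :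
  gen_loc_identifiable R M /\ gen_loc_identifiable R (remove_leaks M).
Proof.
have /cards1P[l leaksE] : #|leaks M| == 1%N by rewrite leakM.
split; apply: (@one_leak_identifiable R n _ l) => //=.
  by rewrite leaksE.
exact: finset.sub0set.
Qed.
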